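(* Let $f,g:E\to\mathbb{R}\cup\{+\infty\}$ be proper, lower semi-continuous and bounded from below (neither is assumed convex), with $f$ $L$-smooth and $\mathcal{J}=f+g$ a Kurdyka–Łojasiewicz (KŁ) function. Let $0<\gamma<\frac1L$, and let $(x_n)_{n\in\mathbb{N}}$ be iterates given by the Forward-Backward algorithm $$x_{n+1}\in\operatorname{prox}_{\gamma g}\bigl(x_n-\gamma\nabla f(x_n)\bigr),\qquad n\in\mathbb{N}.$$ If the iterates $(x_n)$ are bounded, then they converge towards a critical point of $\mathcal{J}=f+g$.
   Context: $E$ is a finite-dimensional Euclidean space with inner product $\langle\cdot,\cdot\rangle$ and norm $\|\cdot\|$. $f$ is $L$-smooth if it is differentiable on $E$ and $\nabla f$ is $L$-Lipschitz. For a possibly nonconvex $g$, $\operatorname{prox}_{\gamma g}(x)$ is the (possibly multivalued) set $\arg\min_{z\in E}g(z)+\frac1{2\gamma}\|z-x\|^2$. Fréchet subdifferential of $F:E\to\mathbb{R}\cup\{+\infty\}$ at a point $x$ with $F(x)<+\infty$: $\hat\partial F(x)=\{\omega\in E:\liminf_{y\to x}\frac{F(y)-F(x)-\langle\omega,y-x\rangle}{\|x-y\|}\ge0\}$. Limiting subdifferential: $\partial F(x)=\{\omega\in E:\exists\, x_n\to x,\ F(x_n)\to F(x),\ \omega_n\to\omega,\ \omega_n\in\hat\partial F(x_n)\}$; $\operatorname{dom}\partial F$ is the set of $x$ where $\partial F(x)\neq\emptyset$. A critical point of $F$ is a point $x\in E$ with $0\in\partial F(x)$. A function $F:E\to\mathbb{R}\cup\{+\infty\}$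 satisfies the KŁ property at $x^*\in\operatorname{dom}\partial F$ if there exist $\eta>0$, a neighborhood $V$ of $x^*$ and a function $\varphi:[0,\eta[\,\to\mathbb{R}_+$ such that: (1) $\varphi(0)=0$; (2) $\varphi$ is $C^1$ on $]0,\eta[$; (3) $\varphi(s)>0$ for all $s\in\,]0,\eta[$; (4) for all $x\in V$ such that $F(x)\in\,]F(x^* ),F(x^* )+\eta[$, $$\varphi'(F(x)-F(x^* ))\,\operatorname{dist}(0,\partial F(x))\ge1,$$ where $\operatorname{dist}(0,S)=\inf_{s\in S}\|s\|$. A KŁ function is a proper lower semi-continuous function satisfying the KŁ property at every point of $\operatorname{dom}\partial F$.
   Formalization: In the KŁ property, item (3) is strengthened: besides φ(s)>0, it is required that φ'(s)>0 for all s in ]0,η[ (the standard condition); with φ>0 alone the claim fails, e.g. for a function supported on a spiral winding towards a circle. *)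

(* Defs.v *)
From HB Require Import structures.
From mathcomp Require Import all_boot all_order all_algebra.
From mathcomp Require Import all_classical all_reals all_analysis.

Set Implicit Arguments.
Unset Strict Implicit.
Unset Printing Implicit Defensive.

Import Order.TTheory GRing.Theory Num.Theory.
Import numFieldNormedType.Exports.

Local Open Scope classical_set_scope.
Local Open Scope ring_scope.

#[short(type="normedVectType")]
HB.structure Definition NormedVector (R : realType) :=
  {E of NormedModule R E & Vector R E}.

(* A Euclidean space is a finite-dimensional normed space whose norm is the
   one induced by an inner product; the topology is the one of the norm. *)
HB.mixin Record NormedVector_isEuclidean (R : realType) E
    of NormedModule R E & Vector R E := {
  dotp : {dot E for (idfun : R -> R)} ;
  dotp_norm : forall x : E, dotp x x = `|x| ^+ 2 }.

#[short(type="euclideanType")]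
HB.structure Definition Euclidean (R : realType) :=
  {E of NormedVector_isEuclidean R E & NormedModule R E & Vector R E}.

Section Defs.
Context {R : realType} {E : euclideanType R}.
Implicit Types (F : E -> \bar R) (x y w : E).

(* Functions E -> R u {+oo} are extended-real functions avoiding -oo. *)
Definition proper_function F : Prop :=
  (forall x, F x != -oo%E) /\ exists x, (F x < +oo)%E.

Definition bounded_below F : Prop := exists m : R, forall x, (m%:E <= F x)%E.

Definition gradient (h : E -> R) x : E :=
  get [set v | forall u, 'd (h : E -> R^o) x u = dotp v u].

(* L-smoothness forces the function to be real-valued. *)
Definition L_smooth (L : R) F : Prop :=
  [/\ forall x, F x \is a fin_num,
      forall x, differentiable (fine \o F : E -> R^o) x &
      forall x y, `|gradient (fine \o F) x - gradient (fine \o F) y|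
                  <= L * `|x - y|].

Definition prox (gamma : R) F x : set E :=
  [set z | forall y, (F z + ((2 * gamma)^-1 * `|z - x| ^+ 2)%:E <=
                      F y + ((2 * gamma)^-1 * `|y - x| ^+ 2)%:E)%E].

Definition frechet_subdiff F x : set E :=
  [set w | (F x < +oo)%E /\
    (0 <= limf_einf
      (fun y => (F y - F x - (dotp w (y - x))%:E) * (`|x - y|^-1)%:E)
      (x^'))%E].

Definition limiting_subdiff F x : set E :=
  [set w | (F x < +oo)%E /\ exists xn wn : nat -> E,
    [/\ xn @ \oo --> x, F (xn n) @[n --> \oo] --> F x, wn @ \oo --> w &
        forall n, frechet_subdiff F (xn n) (wn n)]].

Definition critical_point F x : Prop := limiting_subdiff F x 0.

(* The infimum is +oo on the empty set. *)
Definition dist0 (S : set E) : \bar R :=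
  ereal_inf [set (`|s|)%:E | s in S].

(* [phi : R -> R] only matters on [0, eta[.  The requirement phi' > 0 is part of
   the definition of a desingularizing function; given phi >= 0 on [0, eta[ it
   entails phi > 0 on ]0, eta[, whereas phi > 0 alone would allow phi to
   decrease across the gaps of the range of F. *)
Definition KL_at F (xs : E) : Prop :=
  exists (eta : R) (V : set E) (phi : R -> R),
    [/\ 0 < eta, nbhs xs V & forall s : R, 0 <= s < eta -> 0 <= phi s] /\
    [/\ phi 0 = 0,
        forall s : R, 0 < s < eta -> derivable phi s 1 /\ {for s, continuous (derive1 phi)},
        forall s : R, 0 < s < eta -> 0 < phi s /\ 0 < derive1 phi s &
        forall x, V x -> (F xs < F x < F xs + eta%:E)%E ->
          (1 <= (derive1 phi (fine (F x - F xs)))%:E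
                * dist0 (limiting_subdiff F x))%E].

Definition KL_function F : Prop :=
  [/\ proper_function F, lower_semicontinuous F &
      forall xs, limiting_subdiff F xs !=set0 -> KL_at F xs].

End Defs.

(* Main.v *)
(* Minimality in the prox together with the two quadratic bounds on f gives, with
   c1 = 1 / (2 gamma) - L / 2 > 0 and c2 = 1 / (2 gamma) + L / 2,
     J x_{n+1} + c1 |x_{n+1} - x_n|^2 <= J z + c2 |z - x_n|^2   for every z.
   Hence J x_n decreases to some l, and letting n run along a subsequence tending
   to a cluster point xs gives l <= J z + c2 |z - xs|^2: with lower semicontinuity
   J xs = l, so xs minimises J + c2 |. - xs|^2 and is critical.

   As phi is not assumed concave, the usual telescoping argument is unavailable.
   Instead an Ekeland-type argument shows that the KL inequality is an error
   bound: from x near xs the sublevel set J <= l + s, for 0 < s <= J x - l, lies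
   within distance phi (J x - l) - phi s.  Feeding x = x_n and s = J x_{n+1} - l
   into the inequality above bounds |x_{n+1} - x_n| by
   sqrt (c2 / c1) (phi (J x_n - l) - phi (J x_{n+1} - l)).  This telescopes, and
   phi (J x_n - l) decreases to inf phi, so the iterates starting close enough to
   xs never leave a prescribed ball around it. *)

From HB Require Import structures.
Require Import Defs.
From mathcomp Require Import all_boot all_order all_algebra.
From mathcomp Require Import all_classical all_reals all_analysis.
From mathcomp Require Import ring lra.

Set Implicit Arguments.
Unset Strict Implicit.
Unset Printing Implicit Defensive.

Import Order.TTheory GRing.Theory Num.Theory.
Import numFieldNormedType.Exports.

Local Open Scope classical_set_scope.
Local Open Scope ring_scope.

(** * Inner product, Cauchy-Schwarz inequality, Riesz representation and gradients *)

Section EuclideanSpace.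
Context {R : realType} {E : euclideanType R}.
Implicit Types u v w : E.

Lemma dotpC u v : dotp u v = dotp v u.
Proof. by rewrite hermC expr0 mul1r. Qed.

Lemma dotpDl u v w : dotp (u + v) w = dotp u w + dotp v w.
Proof. exact: linearDl. Qed.

Lemma dotpDr u v w : dotp w (u + v) = dotp w u + dotp w v.
Proof. exact: linearDr. Qed.

Lemma dotpZl (a : R) u v : dotp (a *: u) v = a * dotp u v.
Proof. exact: linearZl_LR. Qed.

Lemma dotpZr (a : R) u v : dotp u (a *: v) = a * dotp u v.
Proof. exact: linearZr_LR. Qed.

Lemma dotpNl u v : dotp (- u) v = - dotp u v.
Proof. exact: linearNl. Qed.

Lemma normrD_sqr u v : `|u + v| ^+ 2 = `|u| ^+ 2 + 2 * dotp u v + `|v| ^+ 2.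
Proof.
by rewrite -!dotp_norm !(dotpDl, dotpDr) (dotpC v u); ring.
Qed.

(** Cauchy-Schwarz: the square of [| |v| u - |u| v |] expands to
    [2 |u| |v| (|u| |v| - dotp u v)]. *)
Lemma dotp_le u v : dotp u v <= `|u| * `|v|.
Proof.
have [->|u0] := eqVneq u 0; first by rewrite linear0l normr0 mul0r.
have [->|v0] := eqVneq v 0; first by rewrite linear0r normr0 mulr0.
have pu : 0 < `|u| by rewrite normr_gt0.
have pv : 0 < `|v| by rewrite normr_gt0.
have : 0 <= `| `|v| *: u + (- `|u|) *: v| ^+ 2 by exact: sqr_ge0.
rewrite normrD_sqr !normrZ dotpZl dotpZr normrN !normr_id !exprMn => h.
rewrite -subr_ge0 -(@pmulr_rge0 _ (2 * (`|u| * `|v|))) ?mulr_gt0//.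
by apply: le_trans h _; rewrite le_eqVlt; apply/orP; left; apply/eqP; ring.
Qed.

Lemma normr_dotp_le u v : `|dotp u v| <= `|u| * `|v|.
Proof.
rewrite ler_norml dotp_le andbT lerNl -dotpNl.
by rewrite (le_trans (dotp_le _ _))// normrN.
Qed.

(** The map sending [v] to [dotp v] is linear and injective from [E] to its dual; the dimensions
    agree, so it is onto. *)
Lemma riesz_representation (l : {linear E -> R^o}) :
  exists v, forall u, l u = dotp v u.
Proof.
have dl v : linear (dotp v : E -> R^o).
  by move=> a u w; rewrite dotpDr dotpZr.
pose D v : {linear E -> R^o} :=
  HB.pack (dotp v : E -> R^o) (GRing.isLinear.Build _ _ _ _ _ (dl v)).
have Pl : linear (fun v => linfun (D v)).
  move=> a u w; apply/lfunP => z.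
  by rewrite add_lfunE scale_lfunE !lfunE /= dotpDl dotpZl.
pose P : {linear E -> 'Hom(E, R^o)} :=
  HB.pack (fun v => linfun (D v)) (GRing.isLinear.Build _ _ _ _ _ Pl).
have kP : lker (linfun P) == 0%VS.
  rewrite -subv0; apply/subvP => v; rewrite memv_ker lfunE /= memv0 => /eqP.
  move=> /lfunP/(_ v); rewrite lfunE zero_lfunE /= dotp_norm => /eqP.
  by rewrite sqrf_eq0 normr_eq0.
have : linfun l \in limg (linfun P).
  suff -> : limg (linfun P) = fullv by rewrite memvf.
  apply/eqP; rewrite eqEdim subvf limg_dim_eq ?(eqP kP) ?capv0//.
  by rewrite !dimvf /= /dim /= muln1.
move=> /memv_imgP[v _ lv]; exists v => u.
by have /lfunP/(_ u) := lv; rewrite !lfunE /= ?lfunE.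
Qed.

Lemma gradientP (h : E -> R) x : differentiable (h : E -> R^o) x ->
  forall u, 'd (h : E -> R^o) x u = dotp (gradient h x) u.
Proof.
move=> dh; have [v lv] := riesz_representation ('d (h : E -> R^o) x).
by rewrite /gradient; case: xgetP => [y _ //|/(_ v)]; exact.
Qed.

End EuclideanSpace.

(** * Cluster points of bounded sequences and minimisation on closed balls *)

Section Compactness.
Import VectorInternalTheory.
Context {R : realType} {E : euclideanType R}.

Lemma normr_coord_le (i : 'I_(dim E)) :
  exists C : R, forall z : E, `|v2r z ord0 i| <= C * `|z|.
Proof.
have cl : linear (fun z : E => v2r z ord0 i : R^o).
  by move=> a z w; rewrite linearP !mxE.
pose l : {linear E -> R^o} :=
  HB.pack (fun z : E => v2r z ord0 i : R^o)
    (GRing.isLinear.Build _ _ _ _ _ cl).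
have [w lw] := riesz_representation l.
by exists `|w| => z; rewrite -[v2r z ord0 i]/(l z) lw normr_dotp_le.
Qed.

(** Coordinates are linear forms, hence bounded by a multiple of the norm, so the coordinate vectors
    stay in a compact box. A cluster point there is carried back to [E] by expanding in the
    basis. *)
Lemma bounded_seq_cluster (u : nat -> E) (M : R) : (forall n, `|u n| <= M) ->
  exists p, forall e N, 0 < e -> exists2 n, (N <= n)%N & `|u n - p| < e.
Proof.
move=> uM; have [C HC] := choice normr_coord_le.
pose v n := v2r (u n).
have cA : compact [set q : 'rV[R]_(dim E) |
    forall i, `[- (`|C i| * M), `|C i| * M]%classic (q ord0 i)].
  apply: (@rV_compact _ _ (fun i => `[- (`|C i| * M), `|C i| * M]%classic)).
  by move=> i; exact: segment_compact.
have [|p' [_ clp]] := cA (v @ \oo) _.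
  exists 0%N => // n _ i /=; rewrite in_itv/= -ler_norml.
  apply: le_trans (HC i (u n)) _.
  apply: le_trans (ler_wpM2l (normr_ge0 _) (uM n)).
  by rewrite ler_wpM2r// ler_norm.
exists (r2v p') => e N e0.
(* An error below [e / (K + 1)] in each coordinate costs less than [e] in norm; the [+ 1] keeps the
   divisor positive. *)
pose K := \sum_(i < dim E) `|r2v (delta_mx ord0 i) : E|.
have K0 : 0 <= K by apply: sumr_ge0.
have K1 : 0 < K + 1 by rewrite ltr_wpDl.
have d0 : 0 < e / (K + 1) by rewrite divr_gt0.
have [_ [[n Nn <-] [_ bq]]] := clp [set v n | n in [set n | (N <= n)%N]]
  (ball p' (e / (K + 1)))
  (ex_intro2 _ _ N I (fun n Nn => ex_intro2 _ _ n Nn erefl))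
  (nbhsx_ballx _ _ d0).
exists n => //.
have -> : u n - r2v p' = \sum_i (v n - p') ord0 i *: r2v (delta_mx ord0 i).
  rewrite -{1}(v2rK (u n)) -linearB /= -/(v n) [X in r2v X]row_sum_delta.
  by rewrite linear_sum; apply: eq_bigr => i _; rewrite linearZ.
apply: le_lt_trans (ler_norm_sum _ _ _) _.
apply: (@le_lt_trans _ _ (e / (K + 1) * K)).
  rewrite mulr_sumr; apply: ler_sum => i _; rewrite normrZ ler_wpM2r// ltW//.
  by rewrite !mxE distrC; exact: bq.
by rewrite -mulrA gtr_pMr// mulrC ltr_pdivrMr// mul1r ltrDl.
Qed.

(** Direct method: a minimising sequence clusters inside the closed ball, and lower semicontinuity
    at the cluster point forbids a value above the infimum. *)
Lemma lsc_ball_min (h : E -> R) (x : E) (rho m : R) : 0 <= rho ->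
  (forall z, `|z - x| <= rho -> m <= h z) ->
  (forall z a, `|z - x| <= rho -> a < h z ->
     exists2 d, 0 < d & forall y, `|y - z| < d -> a < h y) ->
  exists2 z, `|z - x| <= rho & forall y, `|y - x| <= rho -> h z <= h y.
Proof.
move=> rho0 mh lsch.
pose A := [set h z | z in [set z | `|z - x| <= rho]].
have A0 : A !=set0 by exists (h x); exists x => //=; rewrite subrr normr0.
have hA : has_inf A by split => //; exists m => _ [z zr <-]; exact: mh.
have /choice[u uP] n : exists z, `|z - x| <= rho /\
    h z < inf A + n.+1%:R^-1.
  have [|_ [z zr <-] hz] := @inf_adherent _ A n.+1%:R^-1 _ hA.
    by rewrite invr_gt0.
  by exists z.
have [|p pP] := @bounded_seq_cluster u (rho + `|x|).
  move=> n; rewrite -[u n](subrK x) (le_trans (ler_normD _ _))// lerD2r.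
  exact: (uP n).1.
have px : `|p - x| <= rho.
  apply/ler_addgt0Pr => e e0; have [n _ un] := pP e 0%N e0.
  rewrite -(subrK (u n) p) -addrA (le_trans (ler_normD _ _))// [leRHS]addrC.
  by rewrite lerD ?(uP n).1// distrC ltW.
exists p => // y yr; apply: (@le_trans _ _ (inf A)); last first.
  by apply: ge_inf; [exact: hA.2|exists y].
rewrite leNgt; apply/negP => Ap.
have [||d d0 dP] := lsch p ((inf A + h p) / 2) => //; first by lra.
pose e := (h p - inf A) / 2.
have e0 : 0 < e by rewrite /e; lra.
(* For this [n], [n.+1%:R^-1 <= e], so [h (u n)] lies below the midpoint of [inf A] and [h p], while
   lower semicontinuity puts it above. *)
have [n Nn un] := pP d (Num.truncn e^-1) d0.
have := dP _ un; apply/negP; rewrite -leNgt.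
apply: le_trans (ltW (uP n).2) _.
have : n.+1%:R^-1 <= e.
  rewrite -[e]invrK lef_pV2 ?posrE ?invr_gt0//.
  by rewrite (le_trans (ltW (truncnS_gt _)))// ler_nat ltnS.
by rewrite /e; move: n.+1%:R^-1 => q; lra.
Qed.

End Compactness.

(** * Fréchet and limiting subgradients *)

Section Subdifferential.
Context {R : realType} {E : euclideanType R}.
Implicit Types (F : E -> \bar R) (x w : E).

(** An epsilon-delta criterion that replaces the lower limit of extended-real quotients by an affine
    minorant up to [e * |y - x|]. *)
Lemma frechet_subdiffI F x w : F x \is a fin_num ->
  (forall e, 0 < e -> exists2 d, 0 < d & forall y, `|y - x| < d ->
     ((fine (F x) + dotp w (y - x) - e * `|y - x|)%:E <= F y)%E) ->
  frechet_subdiff F x w.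
Proof.
move=> Fx Fw; split; first by rewrite ltey_eq Fx.
apply/lee_addgt0Pr => e e0; rewrite -leeBlDr// sub0e limf_einfE.
have [d d0 dF] := Fw e e0.
apply: ereal_sup_ge; exists (ereal_inf
  ((fun y => ((F y - F x - (dotp w (y - x))%:E) * (`|x - y|^-1)%:E)%E) @`
    (ball x d `\ x))).
  exists (ball x d `\ x) => //.
  apply/nbhs_ballP; exists d => //= y xy yx; split => //.
  exact/eqP.
apply: le_ereal_inf_tmp => _ [y [xy yx] <-].
have {}yx : 0 < `|y - x| by rewrite normr_gt0 subr_eq0; exact/eqP.
have {}xy : `|y - x| < d by move: xy; rewrite -ball_normE /= distrC.
have := dF y xy; rewrite [`|x - y|]distrC.
rewrite -(fineK Fx); case: (F y) => [r||//].
- rewrite !lee_fin => h.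
  by rewrite ler_pdivlMr//= mulNr; lra.
- by move=> _; rewrite -[X in (X * _)%E]/(+oo%E) gt0_mulye ?leey// lte_fin invr_gt0.
Qed.

Lemma frechet_limiting_subdiff F x :
  frechet_subdiff F x `<=` limiting_subdiff F x.
Proof.
move=> w Fw; split; first by have [] := Fw.
by exists (fun=> x), (fun=> w); split => //; exact: cvg_cst.
Qed.

Lemma dist0_le (S : set E) w : S w -> (dist0 S <= `|w|%:E)%E.
Proof. by move=> Sw; apply: ge_ereal_inf; exists `|w|%:E => //; exists w. Qed.

(** The quadratic term is [o(|y - x|)]: it is at most [e * |y - x|] within radius [e / (C + 1)]. *)
Lemma frechet_subdiff0 F x (C : R) : F x \is a fin_num -> 0 <= C ->
  (forall y, (F x <= F y + (C * `|y - x| ^+ 2)%:E)%E) ->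
  frechet_subdiff F x 0.
Proof.
move=> Fx C0 FC; apply: frechet_subdiffI => // e e0.
have C1 : 0 < C + 1 by rewrite ltr_wpDl.
exists (e / (C + 1)); first by rewrite divr_gt0.
move=> y yx; rewrite linear0l addr0 EFinB fineK// leeBlDr//.
apply: le_trans (FC y) _; rewrite leeD2l// lee_fin expr2 mulrA ler_wpM2r//.
rewrite ltr_pdivlMr// in yx; apply: le_trans (ltW yx).
by rewrite mulrC ler_wpM2l// lerDl.
Qed.

End Subdifferential.

(** * Quadratic bounds for smooth functions and the inequality of one iteration *)

Section ForwardBackwardStep.
Context {R : realType} {E : euclideanType R}.

Lemma is_derive_line (h : E -> R) (x u : E) (t : R) :
  differentiable (h : E -> R^o) (x + t *: u) ->
  is_derive t 1 (fun s : R => h (x + s *: u) : R^o)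
    (dotp (gradient h (x + t *: u)) u).
Proof.
move=> dh; pose l : R -> R^o := fun s => h (x + s *: u).
have dE : (fun r : R => r^-1 *: ((l \o shift t) (r *: 1) - l t)) =
    (fun r : R => r^-1 *: (((h : E -> R^o) \o shift (x + t *: u)) (r *: u)
                          - (h : E -> R^o) (x + t *: u))).
  by apply/funext => r; rewrite /l /= [_ *: 1]mulr1 scalerDl addrCA.
split; first by rewrite /derivable dE; exact: diff_derivable.
by rewrite -gradientP// -deriveE// /derive dE.
Qed.

(** The two-sided descent lemma, obtained from the mean value theorem on the segment from [x] to [y]
    rather than from an integral. *)
Lemma smooth_quadratic_bound (h : E -> R) (L : R) :
  (forall x, differentiable (h : E -> R^o) x) ->
  (forall x y, `|gradient h x - gradient h y| <= L * `|x - y|) ->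
  forall x y,
    `|h y - h x - dotp (gradient h x) (y - x)| <= L / 2 * `|y - x| ^+ 2.
Proof.
move=> dh Lh x y; set u := y - x; set c := dotp (gradient h x) u.
(* The sign [s] treats the upper and the lower bound at once. *)
suff H (s : R) : `|s| = 1 -> s * (h y - h x - c) <= L / 2 * `|u| ^+ 2.
  have := H 1 (normr1 _); have := H (-1) (normrN1 _).
  by rewrite ler_norml; lra.
move=> s1.
(* By Cauchy-Schwarz and the Lipschitz bound [k] has nonpositive derivative on [[0, 1]], and
   [k 1 <= k 0] is the claim. *)
pose k (t : R) : R := s * (h (x + t *: u) - t * c) - L / 2 * `|u| ^+ 2 * t ^+ 2.
pose dk (t : R) : R := s * (dotp (gradient h (x + t *: u)) u - c)
  - L * `|u| ^+ 2 * t.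
have kd (t : R) : is_derive t 1 k (dk t).
  have := is_derive_line (dh (x + t *: u)) => hd.
  rewrite /k. apply: is_derive_eq.
  rewrite -[LHS]/(s * (dotp (gradient h (x + t *: u)) u - (t * 0 + c * 1)) -
    (L / 2 * `|u| ^+ 2) * (t * 1 + t * 1)) /dk.
  by move: (dotp _ u) (c) (`|u| ^+ 2) => D d U; clear; field.
have [t t01] := MVT_segment (@ler01 R) (fun t _ => kd t)
  (continuous_subspaceT (fun t => differentiable_continuous
    ((derivable1_diffP _ _).1 (@ex_derive _ _ _ _ _ _ _ (kd t))))).
have dk0 : dk t <= 0.
  have t0 : 0 <= t by move: t01; rewrite in_itv/= => /andP[].
  rewrite /dk subr_le0 /c -[- dotp (gradient h x) u]dotpNl -dotpDl.
  apply: le_trans (ler_norm _) _; rewrite normrM s1 mul1r.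
  apply: le_trans (normr_dotp_le _ _) _.
  have := Lh (x + t *: u) x; rewrite addrAC subrr add0r normrZ ger0_norm//.
  move=> /(ler_wpM2r (normr_ge0 u)) /le_trans; apply.
  by rewrite le_eqVlt; apply/orP; left; apply/eqP; ring.
have -> : h y = h (x + 1 *: u) by rewrite scale1r addrC subrK.
have -> : h x = h (x + 0 *: u) by rewrite scale0r addr0.
move=> kE; have : k 1 - k 0 <= 0 by rewrite kE subr0 mulr1.
rewrite /k; move: (h _) (h _) (c) (`|u| ^+ 2) => a b d U; clear; lra.
Qed.

(* Completing the square in the two proximal terms and bounding [f] by its
   quadratic models at [x] from above at [x'] and from below at [z]. *)
Lemma prox_step (f g : E -> \bar R) (L gamma : R) (x x' : E) :
  0 < gamma -> proper_function g -> L_smooth L f ->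
  prox gamma g (x - gamma *: gradient (fine \o f) x) x' ->
  forall z, (f x' + g x' + (((2 * gamma)^-1 - L / 2) * `|x' - x| ^+ 2)%:E <=
             f z + g z + (((2 * gamma)^-1 + L / 2) * `|z - x| ^+ 2)%:E)%E.
Proof.
move=> gamma0 [gNy _] [ffin df Lf] px z.
have qb y := smooth_quadratic_bound df Lf x y.
set v := gradient (fine \o f) x in px qb *.
have sq y : (2 * gamma)^-1 * `|y - (x - gamma *: v)| ^+ 2 =
    (2 * gamma)^-1 * `|y - x| ^+ 2 + dotp v (y - x) + gamma / 2 * `|v| ^+ 2.
  have -> : y - (x - gamma *: v) = (y - x) + gamma *: v by rewrite opprB addrCA addrC.
  rewrite normrD_sqr dotpZr normrZ gtr0_norm// dotpC exprMn.
  by move: (dotp _ _) (`|y - x| ^+ 2) (`|v| ^+ 2) => D A B; field; exact: lt0r_neq0.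
have := px z; rewrite !sq.
have := qb x'; have := qb z; rewrite !ler_norml /=.
rewrite -(fineK (ffin x')) -(fineK (ffin z)).
move: (gNy z) (gNy x'); case: (g z) => [a||//]; last first.
  by move=> _ _ _ _ _; rewrite addey// addye// leey.
case: (g x') => [b||//] _ _; last by rewrite addye// -EFinD leye_eq.
rewrite -!EFinD !lee_fin.
move: (dotp _ _) (dotp _ _) (`|_| ^+ 2) (`|_| ^+ 2) (`|_| ^+ 2) => D D' A B C.
lra.
Qed.

End ForwardBackwardStep.

(** * One-variable calculus for the desingularizing function *)

Lemma derivable_expansion (R : realType) (phi : R -> R) (b e : R) :
  derivable phi b 1 -> 0 < e ->
  exists2 t, 0 < t & forall d, `|d| < t ->
    `|phi (b + d) - phi b - derive1 phi b * d| <= e * `|d|.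
Proof.
move=> dphi e0.
have /cvgrPdist_le/(_ e e0) : h^-1 *: (phi (h *: 1 + b) - phi b) @[h --> 0^'] -->
  derive1 phi b by rewrite derive1E; exact: dphi.
move=> /nbhs_ballP[t /= t0 tP]; exists t => // d dt.
have [->|d0] := eqVneq d 0; first by rewrite !(addr0, subrr, mulr0, normr0).
have := tP d; rewrite -ball_normE /= sub0r normrN => /(_ dt d0).
rewrite -(@ler_pM2r _ `|d|) ?normr_gt0// -normrM distrC mulrBl.
suff -> : d^-1 *: (phi (d *: 1 + b) - phi b) * d = phi (b + d) - phi b by [].
by rewrite [d *: 1]mulr1 [d + b]addrC [_ *: _]mulrC mulfVK.
Qed.

Lemma derive1_gt0_le (R : realType) (phi : R -> R) (eta : R) :
  (forall s, 0 < s < eta -> derivable phi s 1 /\ 0 < derive1 phi s) ->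
  forall p q, 0 < p -> p <= q -> q < eta -> phi p <= phi q.
Proof.
move=> dphi p q p0 pq qe.
have H t : t \in `]0, eta[%R -> derivable phi t 1 /\ 0 < derive1 phi t.
  by rewrite in_itv/=; exact: dphi.
apply: (@ger0_derive1_le_oo _ phi 0 eta) => //.
- by move=> t /H[].
- by move=> t /H[_ /ltW].
- by move=> t; rewrite inE/= => /H[/derivable1_diffP/differentiable_continuous].
- by rewrite in_itv/= p0 (le_lt_trans pq).
- by rewrite in_itv/= qe andbT (lt_le_trans p0).
Qed.

(** * A smooth substitute for the norm *)

Section SmoothedNorm.
Context {R : realType} {E : euclideanType R}.
Variables (e : R) (e0 : 0 < e).
Implicit Types u v : E.

(** The term [e ^+ 2] removes the kink of the norm at the origin, so a penalty built on it has a
    gradient everywhere. *)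
Definition smoothed_norm u : R := Num.sqrt (`|u| ^+ 2 + e ^+ 2).

Lemma smoothed_norm_sqr u : smoothed_norm u ^+ 2 = `|u| ^+ 2 + e ^+ 2.
Proof. by rewrite sqr_sqrtr// addr_ge0// sqr_ge0. Qed.

Lemma smoothed_norm_gt0 u : 0 < smoothed_norm u.
Proof. by rewrite sqrtr_gt0 ltr_wpDl ?sqr_ge0// exprn_gt0. Qed.

Lemma smoothed_norm0 : smoothed_norm 0 = e.
Proof. by rewrite /smoothed_norm normr0 expr0n/= add0r sqrtr_sqr gtr0_norm. Qed.

Lemma lt_smoothed_norm u : `|u| < smoothed_norm u.
Proof.
rewrite -(@ltr_pXn2r _ 2) ?nnegrE ?(ltW (smoothed_norm_gt0 _))//.
by rewrite smoothed_norm_sqr ltrDl exprn_gt0.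
Qed.

Lemma smoothed_norm_le_eq0 u : smoothed_norm u <= e -> u = 0.
Proof.
rewrite -(@ler_pXn2r _ 2) ?nnegrE ?(ltW (smoothed_norm_gt0 _)) ?(ltW e0)//.
rewrite smoothed_norm_sqr gerDr => h; apply/eqP; rewrite -normr_eq0 -sqrf_eq0.
by rewrite eq_le h sqr_ge0.
Qed.

Lemma smoothed_norm_lip u v : smoothed_norm u <= smoothed_norm v + `|u - v|.
Proof.
have v0 := smoothed_norm_gt0 v.
rewrite -(@ler_pXn2r _ 2) ?nnegrE ?(ltW (smoothed_norm_gt0 _))//; last first.
  by rewrite addr_ge0// ltW.
rewrite sqrrD !smoothed_norm_sqr.
have h : `|u| ^+ 2 <= (`|v| + `|u - v|) ^+ 2.
  rewrite ler_pXn2r ?nnegrE ?addr_ge0//.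
  by rewrite -[X in `|X|](subrK v u) addrC ler_normD.
have : `|v| * `|u - v| <= smoothed_norm v * `|u - v|.
  by rewrite ler_wpM2r// ltW// lt_smoothed_norm.
move: h; rewrite sqrrD.
by move: (smoothed_norm v) `|v| `|u| `|u - v| => S a b c; clear; lra.
Qed.

(** First-order expansion with quadratic remainder: after multiplication by [2 S], with [S] and [T]
    the smoothed norms of [u] and [u + v], it reduces to [0 <= (S - T) ^+ 2]. *)
Lemma smoothed_normD_le u v : smoothed_norm (u + v) <=
  smoothed_norm u + dotp u v / smoothed_norm u + `|v| ^+ 2 / (2 * smoothed_norm u).
Proof.
have u0 := smoothed_norm_gt0 u.
rewrite -(@ler_pM2l _ (2 * smoothed_norm u)) ?mulr_gt0//.
have -> : 2 * smoothed_norm u * (smoothed_norm u + dotp u v / smoothed_norm u +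
    `|v| ^+ 2 / (2 * smoothed_norm u)) =
  2 * smoothed_norm u ^+ 2 + 2 * dotp u v + `|v| ^+ 2.
  by field; exact: lt0r_neq0.
have := sqr_ge0 (smoothed_norm u - smoothed_norm (u + v)).
rewrite sqrrB !smoothed_norm_sqr normrD_sqr.
move: (smoothed_norm u) (smoothed_norm (u + v)) (dotp u v) `|u| `|v|.
by move=> S T D a b; clear; lra.
Qed.

End SmoothedNorm.

(** * The KL inequality as an error bound for sublevel sets *)

Section KLErrorBound.
Context {R : realType} {E : euclideanType R}.
Variables (J : E -> \bar R) (xs : E) (l eta rho : R) (phi : R -> R).
Hypothesis J_Ny : forall x, J x != -oo%E.
Hypothesis J_lsc : lower_semicontinuous J.
Hypothesis phi_derive : forall s, 0 < s < eta ->
  derivable phi s 1 /\ 0 < derive1 phi s.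
Hypothesis KL : forall z b w, `|z - xs| < rho -> 0 < b < eta ->
  J z = (l + b)%:E -> frechet_subdiff J z w -> 1 <= derive1 phi b * `|w|.

Let phi_le := derive1_gt0_le phi_derive.

(* The truncation at [a] keeps the gap [J - l] finite where [J] is [+oo]. *)
Let gap (a : R) (y : E) : R := fine (Order.min (J y) (l + a)%:E) - l.

Let gap_le a y : gap a y <= a.
Proof.
rewrite /gap lerBlDl; case: (J y) (J_Ny y) => [r _||//].
  by rewrite -EFin_min/= ge_min lexx orbT.
by move=> _; rewrite min_r ?leey//=.
Qed.

Let gap_fin a y b : J y = (l + b)%:E -> b <= a -> gap a y = b.
Proof. by move=> Jy ba; rewrite /gap Jy -EFin_min/= min_l; lra. Qed.

Let gap_ub a y t : (J y < (l + t)%:E)%E -> gap a y <= t.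
Proof.
rewrite /gap; case: (J y) (J_Ny y) => [r _||//]; last by [].
rewrite -EFin_min/= lte_fin lerBlDl ge_min => /ltW ->//.
Qed.

Let gap_gt a y t : t < a -> ((l + t)%:E < J y)%E = (t < gap a y).
Proof.
move=> ta; rewrite /gap ltrBrDl; case: (J y) (J_Ny y) => [r _||//].
  by rewrite -EFin_min/= lt_min lte_fin ltrD2l ta andbT.
by move=> _; rewrite min_r ?leey//= ltry ltrD2l.
Qed.

(** A nondecreasing continuous function of a lower semicontinuous one is lower semicontinuous.
    Clipping the gap to [[s, a]] keeps it where [phi] is differentiable. *)
Lemma penalized_gap_lsc (s a e : R) (x z : E) (c : R) :
  0 < s -> s <= a -> a < eta -> 0 < e ->
  c < phi (Order.max s (gap a z)) + smoothed_norm e (z - x) ->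
  exists2 d, 0 < d & forall y, `|y - z| < d ->
    c < phi (Order.max s (gap a y)) + smoothed_norm e (y - x).
Proof.
move=> s0 sa ae e0 cz.
set t0 := Order.max s (gap a z) in cz.
pose k := (phi t0 + smoothed_norm e (z - x) - c) / 2.
have k0 : 0 < k by rewrite /k; lra.
suff [d d0 dP] : exists2 d, 0 < d & forall y, `|y - z| < d ->
    phi t0 - k <= phi (Order.max s (gap a y)).
  exists (Order.min d k); first by rewrite lt_min d0.
  move=> y; rewrite lt_min => /andP[yd yk].
  have := dP y yd; have := smoothed_norm_lip e0 (z - x) (y - x).
  rewrite opprB addrA subrK distrC.
  by move: yk; rewrite /k; lra.
have mle y : Order.max s (gap a y) <= a by rewrite ge_max sa gap_le.
have [zs|sz] := leP (gap a z) s.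
  exists 1 => // y _; rewrite /t0 max_l//.
  apply: (@le_trans _ _ (phi s)); first by rewrite gerBl ltW.
  by apply: phi_le => //; rewrite ?le_max ?lexx// (le_lt_trans (mle y)).
have t0E : t0 = gap a z by rewrite /t0 max_r// ltW.
have t0a : t0 <= a by rewrite t0E.
have [dphi dphi0] : derivable phi t0 1 /\ 0 < derive1 phi t0.
  by apply: phi_derive; rewrite t0E in t0a *; apply/andP; split; lra.
have [t tpos tP] := derivable_expansion dphi (@ltr01 R).
(* Within [t] the expansion of [phi] at [t0] has error at most [q], so lowering [t0] by [q] costs at
   most [q * (derive1 phi t0 + 1) <= k]; [q <= t0 - s] keeps [t0 - q] at or above [s]. *)
pose q := Order.min (Order.min (t / 2) (t0 - s)) (k / (derive1 phi t0 + 1)).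
have q0 : 0 < q.
  have t0s : s < t0 by rewrite t0E.
  by rewrite !lt_min subr_gt0 t0s andbT; apply/andP; split;
    apply: divr_gt0 => //; exact: addr_gt0.
have [qt qs qk] : [/\ q <= t / 2, q <= t0 - s & q * (derive1 phi t0 + 1) <= k].
  split; rewrite /q ?ge_min ?lexx ?orbT//.
  by rewrite -ler_pdivlMr ?addr_gt0// ge_min lexx orbT.
have ktq : phi t0 - k <= phi (t0 - q).
  have := tP (- q); rewrite normrN (gtr0_norm q0) ler_norml => /(_ _)/andP[|].
    by lra.
  by lra.
have [|V zV VP] := J_lsc (x := z) (a := l + (t0 - q)).
  by rewrite (gap_gt (a := a)) -?t0E; lra.
move/nbhs_ballP: zV => [d /= d0 dV]; exists d => // y yz.
have /VP : V y by apply: dV; rewrite -ball_normE /= distrC.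
rewrite (gap_gt (a := a)); last by lra.
move=> gy; apply: (le_trans ktq); apply: phi_le; rewrite ?le_max ?(ltW gy) ?orbT//.
  by lra.
by rewrite (le_lt_trans (mle y)).
Qed.

(* The smoothed norm has slope below [1], so the norm of this subgradient is
   below [1 / phi' b], which the KL inequality forbids. *)
Lemma penalized_gap_frechet (s a b e : R) (x z : E) (r : R) :
  0 < s -> s < b -> b <= a -> a < eta -> 0 < e -> 0 < r ->
  J z = (l + b)%:E ->
  (forall y, `|y - z| < r ->
    phi (Order.max s (gap a z)) + smoothed_norm e (z - x) <=
    phi (Order.max s (gap a y)) + smoothed_norm e (y - x)) ->
  frechet_subdiff J z
    (- (derive1 phi b * smoothed_norm e (z - x))^-1 *: (z - x)).
Proof.
move=> s0 sb ba ae e0 r0 Jz zmin.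
set P := derive1 phi b; set S := smoothed_norm e (z - x); set w := _ *: _.
have [dphi P0] : derivable phi b 1 /\ 0 < P.
  by apply: phi_derive; apply/andP; split; lra.
have S0 : 0 < S by exact: smoothed_norm_gt0.
apply: frechet_subdiffI => [|k k0]; first by rewrite Jz.
pose D := `|w| + k.
have D0 : 0 < D by rewrite ltr_wpDl.
(* If the subgradient inequality fails at [y], minimality leaves [P * k * |y - z|] to be covered by
   two errors. This [del] holds the error in [phi] to half of it, and the bound [P * k * S] on the
   radius below holds the error in the smoothed norm strictly under the other half. *)
pose del := P * k / (2 * D).
have del0 : 0 < del by rewrite divr_gt0// mulr_gt0.
have [t t0 tP] := derivable_expansion dphi del0.
(* For [|c| < d1] the expansion applies at [b + c], which stays between [s] and [eta]. *)
pose d1 := Order.min t (Order.min (b - s) (eta - b)).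
have d10 : 0 < d1 by rewrite !lt_min t0 !subr_gt0 sb (le_lt_trans ba).
pose d := Order.min (d1 / D) (Order.min r (P * k * S)).
have d0 : 0 < d by rewrite !lt_min divr_gt0//= r0 !mulr_gt0.
exists d => // y; rewrite !lt_min => /and3P[yd1 yr ykS].
rewrite ltr_pdivlMr// in yd1.
rewrite Jz /= leNgt; apply/negP => Jy.
pose c := dotp w (y - z) - k * `|y - z|.
have cD : `|c| <= `|y - z| * D.
  rewrite (le_trans (ler_normB _ _))// mulrDr lerD//.
    by rewrite mulrC normr_dotp_le.
  by rewrite normrM normr_id gtr0_norm// mulrC.
have cd1 : `|c| < d1 by exact: le_lt_trans cD yd1.
have [ct [cs ce]] : `|c| < t /\ (- c < b - s /\ c < eta - b).
  move: cd1; rewrite !lt_min => /and3P[-> cs ce]; split => //.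
  by move: cs ce; rewrite !ltr_norml => /andP[+ _] /andP[_ +]; lra.
have yb : gap a y <= b + c by apply: gap_ub; move: Jy; rewrite /c !addrA.
have phiy : phi (Order.max s (gap a y)) <= phi (b + c).
  apply: phi_le; last by lra.
    by rewrite lt_max s0.
  by rewrite ge_max yb andbT; lra.
have zy := zmin y yr.
rewrite -/S in zy.
rewrite (gap_fin Jz ba) in zy.
rewrite (max_r (ltW sb)) in zy.
have := smoothed_normD_le e0 (z - x) (y - z).
rewrite [z - x + _]addrC addrA subrK -/S => Sy.
have := tP c ct; rewrite ler_norml => /andP[_ phib].
have Pc : P * c = - (dotp (z - x) (y - z) / S) - P * k * `|y - z|.
  rewrite /c mulrBr mulrA /w dotpZl.
  by move: (dotp _ _) => q; field; rewrite !lt0r_neq0.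
have delc : del * `|c| <= P * k / 2 * `|y - z|.
  have := ler_wpM2l (ltW del0) cD; congr (_ <= _).
  by rewrite /del; field; rewrite !lt0r_neq0.
have yz0 : 0 < `|y - z|.
  rewrite normr_gt0; apply/eqP => yz; move: Jy.
  by rewrite yz linear0r normr0 mulr0 addr0 subr0 (subr0_eq yz) Jz ltxx.
have yz2 : `|y - z| ^+ 2 / (2 * S) < P * k / 2 * `|y - z|.
  rewrite expr2 -mulrA [ltRHS]mulrC ltr_pM2l// ltr_pdivrMr ?mulr_gt0//.
  by have -> : P * k / 2 * (2 * S) = P * k * S by field.
rewrite -/P Pc in phib.
rewrite [P * k / 2 * _]mulrAC in delc yz2.
move: zy phiy Sy phib delc yz2.
move: (dotp _ _ / S) (`|_| ^+ 2 / _) (phi (b + c)) (phi b) (phi _) => q A F G H.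
move: (smoothed_norm _ _) (del * _) (P * k * _) (S) => T B X S' *.
lra.
Qed.

(** Minimise the penalized gap over the closed ball of radius [rho / 2] around [x]. Comparison with
    [x] bounds the distance to the minimiser [z]; were [J z > l + s], its subgradient would be too
    short for KL. *)
Lemma KL_error_bound (a s e : R) (x : E) :
  0 < s -> s <= a -> a < eta -> 0 < e -> J x = (l + a)%:E ->
  `|x - xs| < rho / 2 -> phi a - phi s + e < rho / 2 ->
  exists2 z, (J z <= (l + s)%:E)%E & `|z - x| <= phi a - phi s + e.
Proof.
move=> s0 sa ae e0 Jx xrho phirho.
have mle y : Order.max s (gap a y) <= a by rewrite ge_max sa gap_le.
have phi_ge y : phi s <= phi (Order.max s (gap a y)).
  by apply: phi_le => //; rewrite ?le_max ?lexx// (le_lt_trans (mle y)).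
have rho0 : 0 < rho / 2 by exact: le_lt_trans xrho.
have [|z zrho zmin] := @lsc_ball_min _ E
    (fun y => phi (Order.max s (gap a y)) + smoothed_norm e (y - x))
    x (rho / 2) (phi s) (ltW rho0) _
    (fun y c _ => @penalized_gap_lsc s a e x y c s0 sa ae e0).
  by move=> y _; rewrite ler_wpDr// ltW// smoothed_norm_gt0.
have zx : phi (Order.max s (gap a z)) + smoothed_norm e (z - x) <= phi a + e.
  have /= := zmin x; rewrite subrr normr0 (ltW rho0) => /(_ isT).
  by rewrite (gap_fin Jx (lexx a)) (max_r sa) smoothed_norm0.
have zx' : `|z - x| < phi a - phi s + e.
  by have := lt_smoothed_norm e0 (z - x); have := phi_ge z; lra.
exists z; last exact: ltW.
rewrite leNgt; apply/negP => sz.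
(* Above level [l + a] the truncated gap is constantly [a], so the comparison with [x] would force
   [z = x]. *)
have Jza : (J z <= (l + a)%:E)%E.
  rewrite leNgt; apply/negP => az.
  have gz : gap a z = a.
    by rewrite /gap min_r ?ltW//=; lra.
  move: zx; rewrite gz max_r// lerD2l => /(smoothed_norm_le_eq0 e0)/eqP.
  by rewrite subr_eq0 => /eqP zx; rewrite zx Jx ltxx in az.
have [b Jz] : exists b, J z = (l + b)%:E.
  case: (J z) sz Jza => [q _ _||//]; last by [].
  by exists (q - l); rewrite addrC subrK.
move: sz Jza; rewrite Jz lte_fin lee_fin ltrD2l lerD2l => sb ba.
have zxs : `|z - xs| < rho.
  rewrite -(subrK x z) -addrA (le_lt_trans (ler_normD _ _))//.
  by lra.
(* The minimiser is interior to the ball, hence a local minimiser without constraint. *)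
have r0 : 0 < rho / 2 - `|z - x| by rewrite subr_gt0 (lt_trans zx').
have be : 0 < b < eta by apply/andP; split; lra.
have [_ P0] := phi_derive be.
have S0 := smoothed_norm_gt0 e0 (z - x).
have zloc y : `|y - z| < rho / 2 - `|z - x| ->
    phi (Order.max s (gap a z)) + smoothed_norm e (z - x) <=
    phi (Order.max s (gap a y)) + smoothed_norm e (y - x).
  move=> yz; apply: zmin; rewrite -(subrK z y) -addrA.
  by rewrite (le_trans (ler_normD _ _))//; lra.
have := KL zxs be Jz (penalized_gap_frechet s0 sb ba ae e0 r0 Jz zloc).
apply/negP; rewrite -ltNge normrZ normrN gtr0_norm ?invr_gt0 ?mulr_gt0//.
rewrite mulrA invfM mulrA mulfV ?lt0r_neq0// mul1r mulrC ltr_pdivrMr// mul1r.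
exact: lt_smoothed_norm.
Qed.

End KLErrorBound.

(** * Convergence of a descent sequence to its cluster point *)

Section DescentSequence.
Context {R : realType} {E : euclideanType R}.
Variables (J : E -> \bar R) (y : nat -> E) (a : nat -> R) (xs : E) (l c1 c2 : R).
Hypothesis J_Ny : forall x, J x != -oo%E.
Hypothesis J_lsc : lower_semicontinuous J.
Hypothesis c1_gt0 : 0 < c1.
Hypothesis c2_gt0 : 0 < c2.
Hypothesis Jy : forall n, J (y n) = (l + a n)%:E.
Hypothesis descent : forall n z,
  ((l + a n.+1 + c1 * `|y n.+1 - y n| ^+ 2)%:E <=
   J z + (c2 * `|z - y n| ^+ 2)%:E)%E.
Hypothesis a_ge0 : forall n, 0 <= a n.
Hypothesis a_cvg0 : forall e, 0 < e -> exists N, forall n, (N <= n)%N -> a n < e.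
Hypothesis xs_cluster : forall e N, 0 < e ->
  exists2 n, (N <= n)%N & `|y n - xs| < e.

Lemma descent_step n : a n.+1 + c1 * `|y n.+1 - y n| ^+ 2 <= a n.
Proof.
have := descent n (y n); rewrite Jy subrr normr0 expr0n/= mulr0 adde0 lee_fin.
by lra.
Qed.

Lemma descent_le n k : a (n + k)%N <= a n.
Proof.
elim: k => [|k IH]; first by rewrite addn0.
rewrite addnS (le_trans _ IH)// (le_trans _ (descent_step _))// lerDl.
by rewrite mulr_ge0 ?sqr_ge0// ltW.
Qed.

Lemma cluster_quadratic_min z : (l%:E <= J z + (c2 * `|z - xs| ^+ 2)%:E)%E.
Proof.
case Jz : (J z) (J_Ny z) => [r||//] _; last by rewrite addye// leey.
rewrite -EFinD lee_fin; apply/ler_addgt0Pr => e e0.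
set A := `|z - xs|; have A0 : 0 <= A by exact: normr_ge0.
have A1 : 0 < 2 * A + 1 by rewrite ltr_wpDl// mulr_ge0.
(* With [d <= 1], [(A + d) ^+ 2 <= A ^+ 2 + (2 * A + 1) * d], and [c2] times the last term is at
   most [e]. *)
pose d := Order.min 1 (e / (c2 * (2 * A + 1))).
have d0 : 0 < d by rewrite lt_min ltr01 divr_gt0// mulr_gt0.
have [n _ nd] := xs_cluster 0%N d0.
have := descent n z; rewrite Jz -EFinD lee_fin => ns.
have zn : `|z - y n| <= A + d.
  rewrite -(subrK xs z) -addrA (le_trans (ler_normD _ _))// lerD2l.
  by rewrite distrC ltW.
have zn2 : c2 * `|z - y n| ^+ 2 <= c2 * (A + d) ^+ 2.
  by rewrite ler_pM2l// ler_pXn2r ?nnegrE ?addr_ge0// ltW.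
have ded : c2 * (A + d) ^+ 2 <= c2 * A ^+ 2 + e.
  have dd : d * (c2 * (2 * A + 1)) <= e.
    by rewrite -ler_pdivlMr ?mulr_gt0// ge_min lexx orbT.
  have d1 : d <= 1 by rewrite ge_min lexx.
  have d2 : c2 * (d * d) <= c2 * d.
    by rewrite ler_pM2l// ler_piMr// ltW.
  by move: dd d2; rewrite sqrrD; move: (c2) (A) (d) (e) => c A' d' e'; lra.
have c1Y : 0 <= c1 * `|y n.+1 - y n| ^+ 2 by rewrite mulr_ge0 ?sqr_ge0// ltW.
by have := a_ge0 n.+1; move: ns c1Y zn2 ded; lra.
Qed.

(** Quadratic minimality at [z = xs] gives [l <= J xs]; lower semicontinuity along iterates near
    [xs], whose values tend to [l], gives the converse. *)
Lemma cluster_value : J xs = l%:E.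
Proof.
apply/eqP; rewrite eq_le; apply/andP; split; last first.
  by have := cluster_quadratic_min xs; rewrite subrr normr0 expr0n/= mulr0 adde0.
rewrite leNgt; apply/negP => lJ.
have [q lq qJ] : exists2 q : R, l < q & (q%:E < J xs)%E.
  move: lJ; case: (J xs) => [r||//]; last by exists (l + 1); rewrite ?ltry// ltrDl.
  by rewrite lte_fin => lr; exists ((l + r) / 2); rewrite ?lte_fin; lra.
have [V /nbhs_ballP[d /= d0 dV] VP] := J_lsc qJ.
have [|N NP] := a_cvg0 (e := q - l); first by rewrite subr_gt0.
have [n Nn nd] := xs_cluster N d0.
have /VP : V (y n) by apply: dV; rewrite -ball_normE /= distrC.
by rewrite Jy lte_fin; have := NP n Nn; lra.
Qed.

Lemma cluster_frechet : frechet_subdiff J xs 0.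
Proof.
apply: (@frechet_subdiff0 _ _ _ _ c2); rewrite ?cluster_value//; first exact: ltW.
exact: cluster_quadratic_min.
Qed.

(** Once the gap vanishes, descent freezes the iterates. This case is separate because [KL_step]
    needs a positive gap. *)
Lemma stationary_cvg N : a N = 0 -> y @ \oo --> xs.
Proof.
move=> aN; have yN k : y (N + k)%N = y N.
  elim: k => [|k IH]; first by rewrite addn0.
  have := descent_step (N + k); have := descent_le N k; rewrite aN -addnS IH.
  move=> ak; have := a_ge0 (N + k.+1) => ak1 yk; apply/eqP.
  rewrite -subr_eq0 -normr_eq0 -sqrf_eq0 -(mulrI_eq0 _ (lregP (lt0r_neq0 c1_gt0))).
  by rewrite eq_le mulr_ge0 ?sqr_ge0 ?(ltW c1_gt0)//; lra.
apply/cvgrPdist_lt => e e0; have [n Nn nd] := xs_cluster N e0.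
exists N => //= m Nm; rewrite distrC -(subnKC Nm) yN.
by rewrite -(yN (n - N)%N) subnKC.
Qed.

Lemma KL_step (eta rho : R) (phi : R -> R) (n : nat) :
  (forall s, 0 < s < eta -> derivable phi s 1 /\ 0 < derive1 phi s) ->
  (forall z b w, `|z - xs| < rho -> 0 < b < eta ->
    J z = (l + b)%:E -> frechet_subdiff J z w -> 1 <= derive1 phi b * `|w|) ->
  0 < a n.+1 -> a n < eta -> `|y n - xs| < rho / 2 ->
  phi (a n) - phi (a n.+1) < rho / 2 ->
  `|y n.+1 - y n| <= Num.sqrt (c2 / c1) * (phi (a n) - phi (a n.+1)).
Proof.
move=> dphi KL an0 an yn phirho; set D := phi _ - phi _ in phirho *.
have san : a n.+1 <= a n by have := descent_le n 1; rewrite addn1.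
have D0 : 0 <= D by rewrite subr_ge0; apply: (derive1_gt0_le dphi).
set K := Num.sqrt _; have K0 : 0 <= K by exact: sqrtr_ge0.
have K1 : 0 < K + 1 by rewrite ltr_wpDl.
apply/ler_addgt0Pr => e e0.
pose d := Order.min (e / (K + 1)) ((rho / 2 - D) / 2).
have d0 : 0 < d by rewrite lt_min divr_gt0//= divr_gt0// subr_gt0.
have dK : K * d <= e.
  apply: (@le_trans _ _ ((K + 1) * d)); first by rewrite ler_wpM2r ?lerDl// ltW.
  by rewrite mulrC -ler_pdivlMr// ge_min lexx.
have dD : D + d < rho / 2.
  have : d <= (rho / 2 - D) / 2 by rewrite ge_min lexx orbT.
  by lra.
(* As [J z <= l + a n.+1], the values cancel in [descent n z], leaving [c1 * |y n.+1 - y n| ^+ 2 <=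
   c2 * (D + d) ^+ 2]. *)
have [z zs zD] := KL_error_bound J_Ny J_lsc dphi KL an0 san an d0 (Jy n) yn dD.
rewrite -/D in zD.
apply: (@le_trans _ _ (K * (D + d))); last by rewrite mulrDr lerD2l.
have Dd0 : 0 <= D + d by rewrite addr_ge0// ltW.
rewrite -(@ler_pXn2r _ 2) ?nnegrE ?(mulr_ge0 K0 Dd0)//.
have cc : 0 <= c2 / c1 by rewrite divr_ge0// ltW.
rewrite exprMn sqr_sqrtr// [leRHS]mulrAC ler_pdivlMr// mulrC.
have zD2 : c2 * `|z - y n| ^+ 2 <= c2 * (D + d) ^+ 2.
  by rewrite ler_pM2l//; apply: lerXn2r => //; rewrite nnegrE.
have := le_trans (descent n z) (leeD2r _ zs); rewrite -EFinD lee_fin.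
by lra.
Qed.

Lemma KL_descent_cvg : KL_at J xs -> y @ \oo --> xs.
Proof.
move=> [eta [V [phi [[eta0 /nbhs_ballP[rho /= rho0 rhoV] phi_ge0]]]]].
move=> [_ phid phi_gt0 KLV].
have dphi s : 0 < s < eta -> derivable phi s 1 /\ 0 < derive1 phi s.
  by move=> se; split; [exact: (phid s se).1|exact: (phi_gt0 s se).2].
have KL z b w : `|z - xs| < rho -> 0 < b < eta ->
    J z = (l + b)%:E -> frechet_subdiff J z w -> 1 <= derive1 phi b * `|w|.
  move=> zxs be Jz Fw.
  have Vz : V z by apply: rhoV; rewrite -ball_normE /= distrC.
  have := KLV z Vz; rewrite Jz cluster_value -EFinB -EFinD !lte_fin ltrDl ltrD2l.
  move=> /(_ be); rewrite addrAC subrr add0r/= => h.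
  rewrite -lee_fin EFinM (le_trans h)// lee_wpmul2l//.
    by rewrite lee_fin ltW// (dphi b be).2.
  by apply: dist0_le; exact: frechet_limiting_subdiff.
have [[N aN]|a_neq0] := pselect (exists N, a N = 0).
  exact: stationary_cvg aN.
have a_gt0 n : 0 < a n.
  by rewrite lt_def a_ge0 andbT; apply/eqP => an; apply: a_neq0; exists n.
(* [KL_at] does not give continuity of [phi] at [0], so [inf A] stands in for the limit of
   [phi (a n)]. *)
pose A := [set phi s | s in [set s | 0 < s < eta]].
have hA : has_inf A.
  split; first by exists (phi (eta / 2)), (eta / 2) => //=; apply/andP; split; lra.
  by exists 0 => _ [s /= /andP[s0 se] <-]; apply: phi_ge0; rewrite ltW.
apply/cvgrPdist_lt => e e0.
set K := Num.sqrt (c2 / c1); have K0 : 0 <= K by exact: sqrtr_ge0.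
have K1 : 0 < K + 1 by rewrite ltr_wpDl.
pose r := Order.min e (rho / 2).
have r0 : 0 < r by rewrite lt_min e0 divr_gt0.
pose d := Order.min (r / 2 / (K + 1)) (rho / 2).
have d0 : 0 < d by rewrite lt_min !divr_gt0.
have drho : d <= rho / 2 by rewrite ge_min lexx orbT.
(* Once the gaps are below [s0], all values [phi (a n)] lie in [[inf A, inf A + d[], so the total
   remaining path is at most [K * d <= r / 2]. *)
have [_ [s0 /= /andP[s00 s0e] <-] s0d] := inf_adherent d0 hA.
have [N0 N0P] := a_cvg0 s00.
have [N N0N Nr] := xs_cluster N0 (divr_gt0 r0 (@ltr0n R 2)).
have aNs k : a (N + k)%N < s0.
  by apply: N0P; rewrite (leq_trans N0N)// leq_addr.
have ae k : 0 < a (N + k)%N < eta by rewrite a_gt0 (lt_trans (aNs k)).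
have phid' i k : phi (a (N + i)%N) - phi (a (N + k)%N) < d.
  have : phi (a (N + i)%N) <= phi s0.
    exact: (derive1_gt0_le dphi (a_gt0 _) (ltW (aNs i)) s0e).
  have : inf A <= phi (a (N + k)%N).
    apply: ge_inf; first exact: hA.2.
    exact: (ex_intro2 _ _ (a (N + k)%N) (ae k) erefl).
  by move: s0d; lra.
have Kd i k : K * (phi (a (N + i)%N) - phi (a (N + k)%N)) <= r / 2.
  apply: (@le_trans _ _ (K * d)); first by rewrite ler_wpM2l// ltW.
  apply: (@le_trans _ _ ((K + 1) * d)); first by rewrite ler_wpM2r ?lerDl// ltW.
  by rewrite mulrC -ler_pdivlMr// ge_min lexx.
(* The bound at [k] keeps [y (N + k)] within [rho / 2] of [xs], which is what [KL_step] requires to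
   pass to [k.+1]. *)
have trap k : `|y (N + k)%N - xs| <=
    `|y N - xs| + K * (phi (a N) - phi (a (N + k)%N)).
  elim: k => [|k IH]; first by rewrite addn0 subrr mulr0 addr0.
  have yk : `|y (N + k)%N - xs| < rho / 2.
    have : r <= rho / 2 by rewrite ge_min lexx orbT.
    have := Kd 0%N k; rewrite addn0. lra.
  have := KL_step dphi KL _ (andP (ae k)).2 yk _.
  rewrite -addnS -/K => /(_ (a_gt0 _)) step.
  have {}step := step (lt_le_trans (phid' k k.+1) drho).
  rewrite -(subrK (y (N + k)%N) (y (N + k.+1)%N)) -addrA.
  rewrite (le_trans (ler_normD _ _))//.
  by move: IH step; rewrite !mulrBr; lra.
exists N => //= m Nm; rewrite distrC -(subnKC Nm).
apply: le_lt_trans (trap _) _.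
have : r <= e by rewrite ge_min lexx.
by have := Kd 0%N (m - N)%N; rewrite addn0; lra.
Qed.

End DescentSequence.

Theorem theorem15 (R : realType) (E : euclideanType R) (f g : E -> \bar R)
    (L gamma : R) (x : nat -> E)
    (f_proper : proper_function f) (f_lsc : lower_semicontinuous f)
    (f_bounded_below : bounded_below f)
    (g_proper : proper_function g) (g_lsc : lower_semicontinuous g)
    (g_bounded_below : bounded_below g)
    (L_gt0 : 0 < L) (f_smooth : L_smooth L f)
    (J_KL : KL_function (fun y => f y + g y)%E)
    (gamma_gt0 : 0 < gamma) (gamma_lt : gamma < 1 / L)
    (x_FB : forall n, prox gamma g
       (x n - gamma *: gradient (fine \o f) (x n)) (x n.+1))
    (x_bounded : bounded_set (range x)) :
  exists2 xs : E, x @ \oo --> xs &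
    critical_point (fun y => f y + g y)%E xs.
Proof.
have [ffin _ _] := f_smooth; have [gNy _] := g_proper.
have [[J_Ny [z0 Jz0]] J_lsc KLJ] := J_KL.
set J : E -> \bar R := (fun y => f y + g y)%E in J_Ny Jz0 J_lsc KLJ *.
have c1_gt0 : 0 < (2 * gamma)^-1 - L / 2.
  rewrite subr_gt0 invfM [ltRHS]mulrC ltr_pM2r ?invr_gt0//.
  by rewrite -(invrK L) ltf_pV2 ?posrE ?invr_gt0// -[L^-1]mul1r.
have c2_gt0 : 0 < (2 * gamma)^-1 + L / 2.
  by rewrite addr_gt0 ?invr_gt0 ?mulr_gt0 ?divr_gt0.
have step n := prox_step gamma_gt0 g_proper f_smooth (x_FB n).
(* The starting point may have [J (x 0) = +oo]; every later iterate has a finite value, by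
   comparison with [z0]. *)
pose y n := x n.+1.
have Jfin n : J (y n) \is a fin_num.
  rewrite fin_numE J_Ny /=; apply/eqP => Jy.
  have := step n z0; rewrite -/(J _) -/(y n) -/(J (y n)) Jy addye// leye_eq.
  by apply/negP; rewrite -ltey lte_add_pinfty// ltry.
pose j n := fine (J (y n)).
have Jj n : J (y n) = (j n)%:E by rewrite fineK.
have [mf fm] := f_bounded_below; have [mg gm] := g_bounded_below.
have hj : has_inf (range j).
  split; first by exists (j 0%N), 0%N.
  exists (mf + mg) => _ [n _ <-]; rewrite -lee_fin -Jj EFinD.
  exact: leeD.
pose l := inf (range j); pose a n := j n - l.
have Ja n : J (y n) = (l + a n)%:E by rewrite Jj /a addrC subrK.
have a_ge0 n : 0 <= a n by rewrite subr_ge0; apply: ge_inf; [exact: hj.2|exists n].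
have descent n z : ((l + a n.+1 + ((2 * gamma)^-1 - L / 2) *
     `|y n.+1 - y n| ^+ 2)%:E <=
   J z + (((2 * gamma)^-1 + L / 2) * `|z - y n| ^+ 2)%:E)%E.
  by rewrite EFinD -Ja; exact: step.
have a_cvg0 e : 0 < e -> exists N, forall n, (N <= n)%N -> a n < e.
  move=> e0; have [_ [N _ <-] jN] := inf_adherent e0 hj.
  exists N => n Nn; rewrite -(subnKC Nn).
  by rewrite (le_lt_trans (descent_le c1_gt0 Ja descent _ _))// ltrBlDl.
have [M [_ MP]] := x_bounded.
have [|xs xs_cl] := @bounded_seq_cluster _ _ y (M + 1).
  by move=> n; apply: (MP (M + 1)); [rewrite ltrDl|exists n.+1].
have crit : critical_point J xs.
  apply: frechet_limiting_subdiff.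
  exact: (cluster_frechet J_Ny J_lsc c1_gt0 c2_gt0 Ja descent a_ge0 a_cvg0 xs_cl).
exists xs => //; rewrite -(cvg_shiftS x).
apply: (KL_descent_cvg J_Ny J_lsc c1_gt0 c2_gt0 Ja descent a_ge0 a_cvg0 xs_cl).
(* Criticality of [xs] puts it in the domain of the limiting subdifferential, where KL is
   available. *)
by apply: KLJ; exists 0.
Qed.
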